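(* Let $\Delta t_{\mathrm{FE}}>0$ and $K>0$, and let $F,\dot F:\mathbb{R}^m\to\mathbb{R}^m$ satisfy, for every $u\in\mathbb{R}^m$, the forward Euler condition \[ \|u +\Delta t\, F(u) \| \leq \| u \| \quad \text{for all } 0\le\Delta t \leq \Delta t_{\mathrm{FE}}, \] and the second derivative condition \[ \|u +\Delta t^2\, \dot{F}(u) \| \leq \| u \| \quad \text{for all } 0\le\Delta t \leq K\, \Delta t_{\mathrm{FE}}. \] Consider an explicit $s$-stage two-derivative method written in the matrix-vector form \[ \mathbf{y} = \mathbf{e}\, u^n + \Delta t\, S\, F(\mathbf{y}) + \Delta t^2\, \hat{S}\, \dot{F}(\mathbf{y}), \] with $S,\hat S\in\mathbb{R}^{(s+1)\times(s+1)}$ the coefficient matrices of the method and $u^{n+1}$ the last component of $\mathbf{y}$. Suppose that for some $r>0$ the following inequalities hold component-wise: \[ \left( I +r S + \frac{r^2}{K^2} \hat{S} \right)^{-1} \mathbf{e} \geq 0, \] \[ r \left( I +r S + \frac{r^2}{K^2} \hat{S} \right)^{-1} S \geq 0, \] \[ \frac{r^2}{K^2} \left( I +r S + \frac{r^2}{K^2} \hat{S} \right)^{-1} \hat{S} \geq 0. \] Then the method preserves the strong stability property $\| u^{n+1} \| \leq \|u^n \|$, for every $u^n\in\mathbb{R}^m$, under the time-step restriction $0\le \Delta t \leq r\, \Delta t_{\mathrm{FE}}$.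
   Context: Here $\|\cdot\|$ denotes any fixed norm, semi-norm, or convex functional on $\mathbb{R}^m$ (real-valued convex function $\mathbb{R}^m\to\mathbb{R}$). $F$ is the right-hand side of a semi-discretized system $u_t=F(u)$, and $\dot F$ is a discretization of the second time derivative $u_{tt}$ (not assumed to equal the exact derivative $F'(u)F(u)$). An explicit $s$-stage two-derivative method with real coefficients $a_{ij},\hat a_{ij}$ ($1\le j<i\le s$) and $b_j,\hat b_j$ ($1\le j\le s$) is \[ y^{(i)} = u^n + \Delta t \sum_{j=1}^{i-1} \left( a_{ij} F(y^{(j)}) + \Delta t\, \hat{a}_{ij} \dot{F}(y^{(j)}) \right),\quad i=1,\dots,s, \] \[ u^{n+1} = u^n + \Delta t \sum_{j=1}^{s} \left( b_{j} F(y^{(j)}) + \Delta t\, \hat{b}_{j} \dot{F}(y^{(j)}) \right). \] Let $A=(a_{ij})$ and $\hat A=(\hat a_{ij})$ be the corresponding strictly lower triangular $s\times s$ matrices (zero on and above the diagonal), $b=(b_1,\dots,b_s)^T$, $\hat b=(\hat b_1,\dots,\hat b_s)^T$, and \[ S= \begin{bmatrix} A & \mathbf{0} \\ b^T & 0 \end{bmatrix}, \qquad \hat{S}= \begin{bmatrix} \hat{A} & \mathbf{0} \\ \hat{b}^T & 0 \end{bmatrix}. \] In the matrix-vector form, $\mathbf{y}=(y^{(1)},\dots,y^{(s)},u^{n+1})^T$ is a vector with $s+1$ entries each in $\mathbb{R}^m$; $F(\mathbf{y})$ and $\dot F(\mathbf{y})$ are obtained by applying $F$ and $\dot F$ to each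 entry; $S$ and $\hat S$ act on such vectors by forming the corresponding linear combinations of entries; $\mathbf{e}\in\mathbb{R}^{s+1}$ is the vector of ones, so $\mathbf{e}\,u^n$ has all entries equal to $u^n$; $I$ is the $(s+1)\times(s+1)$ identity matrix. *)

(* Defs.v *)
From mathcomp Require Import all_boot all_order all_algebra.
From mathcomp Require Import classical_sets reals convex.

Set Implicit Arguments.
Unset Strict Implicit.
Unset Printing Implicit Defensive.

Import Order.TTheory GRing.Theory Num.Theory.
Local Open Scope ring_scope.

Definition strictly_lower (R : realType) (n : nat) (A : 'M[R]_n) : Prop :=
  forall i j : 'I_n, (i <= j)%N -> A i j = 0.

(* [[A, 0], [b^T, 0]], the last row holding the weights of the final update. *)
Definition coef_mx (R : realType) (s : nat) (A : 'M[R]_s) (b : 'cV[R]_s) :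
    'M[R]_(s + 1) :=
  block_mx A 0 b^T 0.

(* A vector of n entries in R^m is stored as an n x m matrix whose i-th row is
   the i-th entry, so that an n x n coefficient matrix acts on it by *m. *)
Definition map_entries (R : realType) (n m : nat) (F : 'rV[R]_m -> 'rV[R]_m)
    (y : 'M[R]_(n, m)) : 'M[R]_(n, m) :=
  \matrix_(i < n) F (row i y).

Definition ones (R : realType) (n : nat) : 'cV[R]_n := const_mx 1.
Arguments ones {R n}.

(* y = (y^(1), ..., y^(s), u^(n+1))^T *)
Definition two_derivative_step (R : realType) (s m : nat)
    (F dotF : 'rV[R]_m -> 'rV[R]_m) (S Shat : 'M[R]_(s + 1))
    (dt : R) (un : 'rV[R]_m) (y : 'M[R]_(s + 1, m)) : Prop :=
  y = ones *m un + dt *: (S *m map_entries F y)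
      + dt ^+ 2 *: (Shat *m map_entries dotF y).

Definition last_entry (R : realType) (s m : nat) (y : 'M[R]_(s + 1, m)) :
    'rV[R]_m :=
  row (rshift s ord0) y.

Definition nonneg_mx (R : realType) (p q : nat) (M : 'M[R]_(p, q)) : Prop :=
  forall i j, 0 <= M i j.

(* Norms and semi-norms on R^m are instances. *)
Definition convex_functional (R : realType) (m : nat) (N : 'rV[R]_m -> R) :
    Prop :=
  @convex_function R 'rV[R]_m setT N.

(* Main.v *)
Require Import Defs.
From mathcomp Require Import all_boot all_order all_algebra.
From mathcomp Require Import classical_sets reals convex.
From mathcomp Require Import interval_inference unstable ring.

Import Order.TTheory GRing.Theory Num.Theory.
Local Open Scope ring_scope.

(** Write [L = r S + (r/K)^2 Shat], so that [M = 1 + L]. Adding [L y] to both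
    sides of the equation defining the method and multiplying by [M^-1] gives
    its Shu-Osher form
<<
      y = M^-1 e un + P (y + (dt / r) F(y)) + Q (y + (K dt / r)^2 dotF(y))
>>
    with [P = r M^-1 S] and [Q = (r/K)^2 M^-1 Shat] ([shu_osher_form]).
    - The time steps occurring here satisfy [dt / r <= dtFE] and
      [K dt / r <= K dtFE], so each parenthesis is a state whose value of [N]
      is at most that of the corresponding entry of [y].
    - All coefficients are nonnegative by assumption, and each row of
      coefficients sums to one, because [M^-1 e + (P + Q) e = M^-1 M e = e]
      ([shu_osher_row_sum]): each entry of [y] is a convex combination.
    - The method is explicit, so [P + Q = M^-1 L] is strictly lower triangular
      ([strictly_lower_resolvent]): an entry of [y] only involves earlier
      entries.

    By strong induction on [i], the [i]-th entry is therefore a convex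
    combination of points of the sublevel set [{x | N x <= N un}], which is
    convex because [N] is ([sublevel_cone_row_mul]), and lies in that set. *)

(** Convex combinations are assembled one summand at a time, and a partial sum
    of weights is not normalized. Hence the cone over the sublevel set, whose
    slice at weight one is the sublevel set itself, and which is closed under
    addition of (weight, point) pairs. *)
Definition sublevel_cone {R : realType} {m : nat} (N : 'rV[R]_m -> R) (c : R)
    (w : R) (p : 'rV[R]_m) : Prop :=
  0 <= w /\ exists2 x, N x <= c & p = w *: x.

Lemma sublevel_cone1 (R : realType) (m : nat) (N : 'rV[R]_m -> R) c p :
  sublevel_cone N c 1 p -> N p <= c.
Proof. by case=> _ [x Nx ->]; rewrite scale1r. Qed.

Lemma sublevel_coneD (R : realType) (m : nat) (N : 'rV[R]_m -> R) c w1 w2 p q :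
  convex_functional N -> sublevel_cone N c w1 p -> sublevel_cone N c w2 q ->
  sublevel_cone N c (w1 + w2) (p + q).
Proof.
move=> convN [w1_ge0 [x Nx ->]] [w2_ge0 [y Ny ->]].
split; first exact: addr_ge0.
have [w0|w_neq0] := eqVneq (w1 + w2) 0.
  (* Both weights vanish, so any point of the sublevel set will do. *)
  exists x => //; move/eqP: w0; rewrite paddr_eq0// => /andP[/eqP-> /eqP->].
  by rewrite !scale0r !addr0 scale0r.
have w_gt0 : 0 < w1 + w2 by rewrite lt_def w_neq0 addr_ge0.
have t_ge0 : 0 <= w1 / (w1 + w2) by rewrite divr_ge0// ltW.
have t_le1 : w1 / (w1 + w2) <= 1 by rewrite ler_pdivrMr// mul1r lerDl.
pose t := w1 / (w1 + w2).
have tC : t.~ = w2 / (w1 + w2).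
  by rewrite /onem -[1](divff w_neq0) -mulrBl addrC addKr.
exists (t *: x + t.~ *: y); last first.
  by rewrite tC scalerDr !scalerA ![_ * (_ / _)]mulrC !divfK.
have := convN (Itv01 t_ge0 t_le1) x y; rewrite !inE => /(_ I I).
move/le_trans; apply.
have -> : c = t * c + t.~ * c by rewrite -mulrDl add_onemK mul1r.
apply: lerD; apply: ler_wpM2l => //.
by rewrite /= tC divr_ge0// ltW.
Qed.

(** Every weight, zero included, must come with a point of the sublevel set;
    [x0] is that point when the weight is zero and nothing is known about the
    matching row of [X]. *)
Lemma sublevel_cone_row_mul (R : realType) (m n p : nat) (N : 'rV[R]_m -> R) c
    x0 (B : 'M[R]_(p, n)) (X : 'M[R]_(n, m)) i :
  convex_functional N -> N x0 <= c -> nonneg_mx B ->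
  (forall j, B i j != 0 -> N (row j X) <= c) ->
  sublevel_cone N c (\sum_j B i j) (row i (B *m X)).
Proof.
move=> convN Nx0 B_ge0 NX; rewrite row_mul mulmx_sum_row.
under [X in sublevel_cone _ _ _ X]eq_bigr do rewrite mxE.
elim/big_ind2 : _ => [|w1 u w2 v| j _].
- by split=> //; exists x0; rewrite ?scale0r.
- exact: sublevel_coneD.
split; first exact: B_ge0.
have [->|Bij_neq0] := eqVneq (B i j) 0; first by exists x0; rewrite ?scale0r.
by exists (row j X); rewrite ?NX.
Qed.

Lemma strictly_lower_coef_mx (R : realType) (s : nat) (A : 'M[R]_s) b :
  strictly_lower A -> strictly_lower (coef_mx A b).
Proof.
move=> A0 i j; rewrite /coef_mx.
case: (split_ordP i) => k ->; case: (split_ordP j) => l ->.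
- by rewrite block_mxEul; apply: A0.
- by rewrite block_mxEur mxE.
- by rewrite /= leqNgt (leq_trans (ltn_ord l)) ?leq_addr.
- by rewrite block_mxEdr mxE.
Qed.

Lemma strictly_lower_lin (R : realType) (n : nat) (a a' : R) (B C : 'M[R]_n) :
  strictly_lower B -> strictly_lower C -> strictly_lower (a *: B + a' *: C).
Proof. by move=> B0 C0 i j ij; rewrite !mxE B0// C0// !mulr0 addr0. Qed.

Lemma unitmx_1D_strictly_lower (R : realType) (n : nat) (L : 'M[R]_n) :
  strictly_lower L -> 1%:M + L \in unitmx.
Proof.
move=> L0; rewrite unitmxE det_trig.
  by rewrite big1 ?unitr1// => i _; rewrite !mxE eqxx L0// addr0.
apply/is_trig_mxP => i j ij; rewrite !mxE L0 1?ltnW// addr0.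
by rewrite -val_eqE ltn_eqF.
Qed.

(** The matrix [T = (1 + L)^-1 L] solves [T = L - L T], and row [i] of [L T]
    only involves the rows of [T] of index less than [i]. *)
Lemma strictly_lower_resolvent (R : realType) (n : nat) (L : 'M[R]_n) :
  strictly_lower L -> strictly_lower (invmx (1%:M + L) *m L).
Proof.
move=> L0; set T := _ *m L.
have TE : T = L - L *m T.
  apply/eqP; rewrite -subr_eq0 opprB addrA subr_eq0 -[X in X + _]mul1mx.
  by rewrite -mulmxDl mulKVmx// unitmx_1D_strictly_lower.
move=> i; elim/ltn_ind: {i}(val i) {-2}i (erefl (val i)) => k IH i ik j ij.
rewrite TE !mxE L0// big1 ?subr0// => l _.
have [il|li] := leqP i l; first by rewrite L0// mul0r.
by rewrite (IH l)// ?mulr0 -?ik// (leq_trans (ltnW li)).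
Qed.

(** The left-hand side is [M^-1 (1 + r S + k Shat) = M^-1 M]. *)
Lemma shu_osher_weights (R : realType) (n : nat) (r k : R) (S Shat : 'M[R]_n) :
  let M := 1%:M + r *: S + k *: Shat in
  M \in unitmx ->
  invmx M + r *: (invmx M *m S) + k *: (invmx M *m Shat) = 1%:M.
Proof.
move=> M M_unit.
by rewrite !scalemxAr -{1}[invmx M]mulmx1 -!mulmxDr mulVmx.
Qed.

Lemma shu_osher_row_sum (R : realType) (n : nat) (r k : R) (S Shat : 'M[R]_n)
    (i : 'I_n) :
  let M := 1%:M + r *: S + k *: Shat in
  M \in unitmx ->
  (invmx M *m ones) i ord0 + \sum_j (r *: (invmx M *m S)) i j
    + \sum_j (k *: (invmx M *m Shat)) i j = 1.
Proof.
move=> M M_unit.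
have sumE (B : 'M[R]_n) : \sum_j B i j = (B *m ones) i ord0.
  by rewrite mxE; apply: eq_bigr => j _; rewrite mxE mulr1.
have := congr1 (fun B : 'M[R]_n => (B *m ones) i ord0)
  (shu_osher_weights _ _ r k S Shat M_unit).
by rewrite mul1mx !mulmxDl !sumE [ones i _]mxE => <-; rewrite !mxE.
Qed.

(** Multiplying by [M] moves [r S y + k Shat y] to the left-hand side and leaves
    the equation of the method. In the application [r * a] is the time step,
    [k * a'] its square, and [f], [g] are the values of the two right-hand
    sides at [y]; they are kept independent of [y] as the identity is linear. *)
Lemma shu_osher_form (R : realType) (n m : nat) (r k a a' : R)
    (S Shat : 'M[R]_n) (x : 'rV[R]_m) (y f g : 'M[R]_(n, m)) :
  let M := 1%:M + r *: S + k *: Shat in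
  M \in unitmx ->
  y = ones *m x + (r * a) *: (S *m f) + (k * a') *: (Shat *m g) ->
  y = (invmx M *m ones) *m x + (r *: (invmx M *m S)) *m (y + a *: f)
      + (k *: (invmx M *m Shat)) *m (y + a' *: g).
Proof.
move=> M M_unit yE; apply: (can_inj (mulKmx M_unit)).
rewrite !mulmxDr -!scalemxAl -!scalemxAr -!mulmxA !scalemxAr !mulKVmx//.
rewrite /M !mulmxDl mul1mx {1}yE -!scalemxAl -!scalemxAr !scalerA.
rewrite [r * a]mulrC [k * a']mulrC.
by rewrite [LHS](AC 5 ((1 * (4 * 2)) * (5 * 3))%AC).
Qed.

Theorem theorem2 (R : realType) (m s : nat) (N : 'rV[R]_m -> R)
    (F dotF : 'rV[R]_m -> 'rV[R]_m) (dtFE K : R)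
    (A Ahat : 'M[R]_s) (b bhat : 'cV[R]_s) (r : R) :
  convex_functional N ->
  0 < dtFE -> 0 < K ->
  (forall (u : 'rV[R]_m) (dt : R), 0 <= dt -> dt <= dtFE ->
     N (u + dt *: F u) <= N u) ->
  (forall (u : 'rV[R]_m) (dt : R), 0 <= dt -> dt <= K * dtFE ->
     N (u + dt ^+ 2 *: dotF u) <= N u) ->
  strictly_lower A -> strictly_lower Ahat ->
  0 < r ->
  let S := coef_mx A b in
  let Shat := coef_mx Ahat bhat in
  let M := 1%:M + r *: S + (r ^+ 2 / K ^+ 2) *: Shat in
  nonneg_mx (invmx M *m ones) ->
  nonneg_mx (r *: (invmx M *m S)) ->
  nonneg_mx ((r ^+ 2 / K ^+ 2) *: (invmx M *m Shat)) ->
  forall (un : 'rV[R]_m) (dt : R) (y : 'M[R]_(s + 1, m)),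
    0 <= dt -> dt <= r * dtFE ->
    two_derivative_step F dotF S Shat dt un y ->
    N (last_entry y) <= N un.
Proof.
move=> convN _ K_gt0 FE SD A0 Ahat0 r_gt0 S Shat M.
set P := r *: _; set Q := _ *: (_ *m Shat) => v_ge0 P_ge0 Q_ge0.
move=> un dt y dt_ge0 dt_le.
rewrite /two_derivative_step; set f := map_entries F y.
set g := map_entries dotF y => yE.
have r_neq0 := lt0r_neq0 r_gt0; have K_neq0 := lt0r_neq0 K_gt0.
pose a := dt / r; pose c := K * a.
have a_ge0 : 0 <= a by rewrite divr_ge0// ltW.
have a_le : a <= dtFE by rewrite ler_pdivrMr// mulrC.
have L0 : strictly_lower (r *: S + (r ^+ 2 / K ^+ 2) *: Shat).
  by apply: strictly_lower_lin; apply: strictly_lower_coef_mx.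
have ME : M = 1%:M + (r *: S + (r ^+ 2 / K ^+ 2) *: Shat) by rewrite /M addrA.
have M_unit : M \in unitmx by rewrite ME unitmx_1D_strictly_lower.
have PQ0 : strictly_lower (P + Q).
  by rewrite /P /Q !scalemxAr -mulmxDr ME; apply: strictly_lower_resolvent.
have {}yE : y = (invmx M *m ones) *m un + P *m (y + a *: f)
                + Q *m (y + c ^+ 2 *: g).
  apply: shu_osher_form => //; rewrite [LHS]yE; congr (_ + _ *: _ + _ *: _).
    by rewrite /a mulrC divfK.
  by rewrite /c /a !exprMn exprVn; field; rewrite r_neq0 K_neq0.
(* The last entry is a combination of the stages, so the induction has to bound
   all of them. *)
suff Ny i : N (row i y) <= N un by apply: Ny.
elim/ltn_ind: {i}(val i) {-2}i (erefl (val i)) => l IH i il.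
(* Nonnegativity of both weights turns the vanishing of their sum into the
   vanishing of each. *)
have earlier j : P i j + Q i j != 0 -> N (row j y) <= N un.
  move=> PQ_neq0; apply: (IH j) => //; rewrite -il ltnNge.
  by apply: contraNN PQ_neq0 => ij; have := PQ0 i j ij; rewrite mxE => ->.
have earlierP j : P i j != 0 -> N (row j y) <= N un.
  move=> P_neq0; apply: earlier; rewrite paddr_eq0 ?P_ge0 ?Q_ge0//.
  by rewrite negb_and P_neq0.
have earlierQ j : Q i j != 0 -> N (row j y) <= N un.
  move=> Q_neq0; apply: earlier; rewrite paddr_eq0 ?P_ge0 ?Q_ge0//.
  by rewrite negb_and Q_neq0 orbT.
apply: sublevel_cone1; rewrite -(shu_osher_row_sum _ _ _ _ _ _ i M_unit).
rewrite {1}yE !(linearD (row i)) /=.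
apply: sublevel_coneD => //; first apply: sublevel_coneD => //.
- split; first exact: v_ge0.
  exists un => //; apply/rowP => j.
  by rewrite !mxE big_ord1 !mxE.
- apply: (@sublevel_cone_row_mul _ _ _ _ _ _ un) => // j Pij.
  apply: le_trans (earlierP j Pij).
  by rewrite linearD linearZ /= rowK; apply: FE.
- apply: (@sublevel_cone_row_mul _ _ _ _ _ _ un) => // j Qij.
  apply: le_trans (earlierQ j Qij).
  rewrite linearD linearZ /= rowK; apply: SD.
    by rewrite mulr_ge0// ltW.
  by rewrite ler_wpM2l// ltW.
Qed.
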